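(* There is no finite set $Q$ of primes with $2,3\notin Q$ and $|Q|\in\{5,6\}$ such that $$3\cdot \prod_{q\in Q}(q-1) - 2\prod_{q\in Q} q = 2.$$ Consequently, every positive integer $n$ with $\phi(n)=\frac{2}{3}(n+1)$ ($\phi$ Euler's totient) that is not in $\{5,\ 5\cdot 7,\ 5\cdot 7\cdot 37,\ 5\cdot 7\cdot 37\cdot 1297\}$ has at least seven distinct prime factors. *)

(* Defs.v *)
From mathcomp Require Export all_boot all_order all_algebra.
From mathcomp Require Export finmap.

(* Main.v *)
Require Import Defs.
From mathcomp Require Import all_boot all_order all_algebra.
From mathcomp Require Import finmap.
From Stdlib Require Import NArith Lia.
From mathcomp Require Import zify ring.

(* Order the primes as q_1 < ... < q_k and write the equation as
   A * prod (q_i - 1) = B * prod q_i + 2 with A = 3 and B = 2.  Absorbing the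
   smallest prime q into the coefficients replaces (A, B) by (A (q-1), B q), and
   d := A - B stays positive, whence A / d < q.  On the other hand
   prod (1 - 1/q_i) >= 1 - k/q_1, whence d q_1 <= k A + 2.  So the primes can be
   chosen one after the other in finite intervals, and the last one is
   (A + 2) / d.  Two facts keep this search small: no prime of the list is 1
   modulo another one p, as otherwise p would divide 2; and the equation for the
   last two primes q, r is (d q - A) (d r - A) = A^2 - d A + 2 d, so that
   d q - A has to divide a number which does not depend on q.
   An n with 3 phi(n) = 2 (n + 1) is squarefree and prime to 6, so its primes
   satisfy the equation. *)

(** * Sieves and the search procedure *)

Definition small_primes : seq N :=
  [:: 5; 7; 11; 13; 17; 19; 23; 29; 31; 37; 41; 43; 47; 53; 59; 61]%num.

(** Only a necessary condition for primality: composite candidates that slip through lengthen the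
    search but do not make it unsound. *)
Definition plausible (q : N) : bool :=
  all (fun p => if N.eqb (N.modulo q p) 0 then N.eqb q p else true)
    small_primes.

(** Of the prime factors of 210 only 2 and 3 are sieved out, since 5 and 7 may occur in a
    solution. *)
Definition wheel0 : seq N :=
  [seq N.of_nat i | i <- [seq i <- iota 0 210 | coprime i 6]].

(** The classes 0 and 1 modulo [p] hold no later prime of a solution; they are unions of classes
    modulo 210 when [p] divides 210. *)
Definition refine (p : N) (W : seq N) : seq N :=
  if N.eqb (N.modulo 210 p) 0 then [seq x <- W | N.ltb 1 (N.modulo x p)] else W.

Fixpoint scan (f : N -> bool) (W : seq N) (j : N) (n : nat) : bool :=
  if n is n'.+1 then
    if all (fun x => f (j + x)%num) W then scan f W (j + 210)%num n' else false
  else true.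

Fixpoint odd_part (p : positive) : positive :=
  if p is xO p' then odd_part p' else p.

(* Exact division from the low-order bits: for odd s, s divides m if and only if
   it divides the odd part of m - s.  This is much cheaper than [N.modulo].  The
   answer is [true] when the fuel runs out. *)
Fixpoint odd_dvd_test (fuel : nat) (s m : positive) : bool :=
  if fuel is fuel'.+1 then
    match Pos.sub_mask m s with
    | IsNul => true
    | IsPos x => odd_dvd_test fuel' s (odd_part x)
    | IsNeg => false
    end
  else true.

Definition dvd_test (u c : N) : bool :=
  match u, c with
  | Npos s, Npos m => odd_dvd_test 100 (odd_part s) (odd_part m)
  | _, _ => true
  end.

(* [true] implies that every admissible list s of k+1 primes with
   A * prod (q - 1) = B * prod q + 2 has B * prod q in [allowed], see
   [searchP].
   [last] is the prime chosen before, W contains the residues modulo 210 of the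
   primes still to be chosen.  Plain [if] is used instead of [&&] and [||], of
   which the call-by-value [vm_compute] would evaluate both sides. *)
Fixpoint search (allowed : seq N) (k : nat) (W : seq N) (last A B : N) : bool :=
  if N.leb A B then true else
  let d := (A - B)%num in
  if k is k'.+1 then
    let c := (A * A - d * A + 2 * d)%num in
    let W' := refine last W in
    let lo := N.max last (N.div A d) in
    let hi := N.div (N.of_nat k.+1 * A + 2) d in
    scan (fun q =>
      if (if N.ltb lo q then N.ltb hi q else true) then true else
      if (if k' is 0 then dvd_test (d * q - A)%num c else plausible q) then
        if search allowed k' W' q (A * (q - 1))%num (B * q)%num then true
        else ~~ plausible q
      else true) W' (210 * (lo / 210))%num (N.to_nat (hi / 210 - lo / 210)).+1
  else
    if N.eqb (N.modulo (A + 2) d) 0 then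
      let r := N.div (A + 2) d in
      if plausible r then
        if N.leb r last then true else (B * r)%num \in allowed
      else true
    else true.

(* Twice the products 5, 5*7, 5*7*37 and 5*7*37*1297. *)
Definition known_doubles : seq N := [:: 10; 70; 2590; 3359230]%num.

Definition prodN (s : seq N) : N := foldr N.mul 1%num s.

Definition prod_predN (s : seq N) : N := prodN [seq (q - 1)%num | q <- s].

(** * Soundness of the divisibility test and of the scan *)

Lemma odd_part_odd (p : positive) : N.odd (Npos (odd_part p)).
Proof. by elim: p. Qed.

Lemma odd_part_dvd (p : positive) : Pos.divide (odd_part p) p.
Proof.
elim: p => [p _|p [c e]|] /=; [by exists 1%positive | | by exists 1%positive].
by exists (xO c); rewrite [in LHS]e.
Qed.

(** If an odd [s] divides an even number, the cofactor is even, so both can be halved. *)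
Lemma dvd_odd_part (s m : positive) :
  N.odd (Npos s) -> Pos.divide s m -> Pos.divide s (odd_part m).
Proof.
move=> os; elim: m => //= m IH [c e]; apply: IH.
case: c e => [c|c|] e;
  [by case: s os e | by exists c; lia | by move: e os => /= <-].
Qed.

Lemma odd_dvd_testP (n : nat) (s m : positive) :
  N.odd (Npos s) -> Pos.divide s m -> odd_dvd_test n s m.
Proof.
move=> os; elim: n m => //= n IH m dv.
case: Pos.sub_mask_spec => // [p e|p e].
  apply: IH; apply: dvd_odd_part => //; apply: (Pos.divide_add_cancel_l s p s).
    by exists 1%positive.
  by rewrite Pos.add_comm e.
by case: dv => c; nia.
Qed.

Lemma dvd_testP (u c : N) : N.divide u c -> dvd_test u c.
Proof.
case: u c => [|s] [|m] // [c e]; rewrite /dvd_test.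
apply: odd_dvd_testP; first exact: odd_part_odd.
apply: dvd_odd_part; first exact: odd_part_odd.
have [k ek] := odd_part_dvd s.
case: c e => [|c] // [->]; exists (c * k)%positive.
by rewrite {1}ek Pos.mul_assoc.
Qed.

#[local] Arguments N.mul : simpl never.
#[local] Arguments N.add : simpl never.
#[local] Arguments N.of_nat : simpl never.

Lemma scanP (f : N -> bool) (W : seq N) (j : N) (n : nat) (q : N) :
  scan f W (210 * j)%num n -> (j <= q / 210 < j + N.of_nat n)%num ->
  N.modulo q 210 \in W -> f q.
Proof.
elim: n j => [|n IH] j /=; first lia.
case: ifP => // /allP fW sc hq qW.
have [e|ne] := N.eq_dec j (q / 210)%num.
  by have := fW _ qW; rewrite e -N.div_mod.
have sc' : scan f W (210 * (j + 1))%num n by rewrite N.mul_add_distr_l.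
by apply: IH sc' _ qW; lia.
Qed.

#[local] Arguments scan : simpl never.

(** * Bounds, residues and divisibility for solutions *)

Lemma prod_predN_gt0 (s : seq N) : all (N.ltb 1) s -> (0 < prod_predN s)%num.
Proof. by rewrite /prod_predN; elim: s => //= x s IH /andP[x1 /IH]; nia. Qed.

Lemma prod_predN_le (s : seq N) : (prod_predN s <= prodN s)%num.
Proof. by rewrite /prod_predN; elim: s => //= x s IH; nia. Qed.

(** For [q > 0] this is the bound prod (1 - 1/x) >= 1 - n/q for n entries x >= q, cleared of
    denominators. *)
Lemma prodN_le_prod_predN (q : N) (s : seq N) :
  all (N.leb q) s ->
  (q * prodN s <= q * prod_predN s + N.of_nat (size s) * prodN s)%num.
Proof.
rewrite /prod_predN; elim: s => [|x s IH] /=; first lia.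
case/andP=> /N.leb_le qx /IH; set P := prodN s; set P' := prodN _ => h.
have [->|x0] := N.eq_dec x 0; first nia.
have [y e] : exists y, (x = y + 1)%num by exists (x - 1)%num; lia.
subst x.
have -> : (y + 1 - 1 = y)%num by lia.
(* The induction hypothesis times [y]; the remaining [q * P] is absorbed by one more copy of
   [(y + 1) * P]. *)
have h' : (y * (q * P) <= y * (q * P' + N.of_nat (size s) * P))%num.
  exact: N.mul_le_mono_l.
have qP : (q * P <= (y + 1) * P)%num by apply: N.mul_le_mono_r; lia.
nia.
Qed.

(* The congruence is only used when the residues modulo 210 determine it. *)
Definition admissible (p q : N) : bool :=
  N.ltb p q &&
  (if N.eqb (N.modulo 210 p) 0 then N.ltb 1 (N.modulo q p) else true).

Lemma refineP (p q : N) (W : seq N) :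
  admissible p q -> N.modulo q 210 \in W -> N.modulo q 210 \in refine p W.
Proof.
case/andP=> /N.ltb_lt pq; rewrite /refine; case: ifP => // /N.eqb_eq p210 h qW.
rewrite mem_filter qW andbT.
have p0 : (p <> 0)%num by move=> e; rewrite e in p210.
suff -> : ((q mod 210) mod p = q mod p)%num by [].
have e210 : (210 = p * (210 / p))%num.
  by rewrite [LHS](N.div_mod _ p) // p210 N.add_0_r.
have eq : (q = q mod 210 + 210 / p * (q / 210) * p)%num.
  have := f_equal (N.mul (q / 210)) e210; have := N.div_mod q 210.
  move: (q / 210)%num (q mod 210)%num (210 / p)%num => x y z.
  by move=> e1 e2; have := e1 ltac:(discriminate); lia.
by rewrite [in RHS]eq N.Div0.mod_add.
Qed.

Lemma balanced_gt (A B : N) (s : seq N) :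
  (A * prod_predN s = B * prodN s + 2)%num -> (B < A)%num.
Proof.
have := prod_predN_le s; set P := prodN s; set P' := prod_predN s => h e.
case: (N.lt_ge_cases B A) => // le.
by have := N.mul_le_mono _ _ _ _ le h; lia.
Qed.

(** With P the product and n the size, the equation times [q] and the product bound times [A] give d
    q P <= n A P + 2 q. Then [q <= P] lets P be cancelled. *)
Lemma balanced_head_le (A B q : N) (s : seq N) :
  all (N.leb q) s -> (0 < q)%num -> (q <= prodN s)%num ->
  (A * prod_predN s = B * prodN s + 2)%num ->
  ((A - B) * q <= N.of_nat (size s) * A + 2)%num.
Proof.
move=> qs q0 qP e; have AB := balanced_gt _ _ _ e.
have := prodN_le_prod_predN _ _ qs; move: qP e.
set P := prodN s; set P' := prod_predN s; set n := N.of_nat _ => qP e h.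
have h' := N.mul_le_mono_l _ _ A h; have e' := f_equal (N.mul q) e.
apply: (proj2 (N.mul_le_mono_pos_r _ _ P _)); first lia.
have [d eA] : exists d, (A = B + d)%num by exists (A - B)%num; lia.
have -> : (A - B = d)%num by lia.
subst A; lia.
Qed.

Lemma last_two_dvd (A B q r : N) :
  (0 < q)%num -> (0 < r)%num ->
  (A * ((q - 1) * (r - 1)) = B * (q * r) + 2)%num ->
  N.divide ((A - B) * q - A)%num (A * A - (A - B) * A + 2 * (A - B))%num.
Proof.
move=> q0 r0 e.
have AB : (B < A)%num.
  by apply: (balanced_gt A B [:: q; r]); rewrite /prod_predN /= !N.mul_1_r.
(* [Aq] and [Ar] amount to A < d q and A < d r, so the truncated subtractions below are exact. *)
have Aq : (B * q < A * (q - 1))%num.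
  by apply: (balanced_gt _ _ [:: r]); rewrite /prod_predN /= !N.mul_1_r; lia.
have Ar : (B * r < A * (r - 1))%num.
  by apply: (balanced_gt _ _ [:: q]); rewrite /prod_predN /= !N.mul_1_r; lia.
have [d eA] : exists d, (A = B + d)%num by exists (A - B)%num; lia.
have [x eq] : exists x, (q = x + 1)%num by exists (q - 1)%num; lia.
have [y er] : exists y, (r = y + 1)%num by exists (r - 1)%num; lia.
have -> : (A - B = d)%num by lia.
have [u eu] : exists u, (d * q = A + u)%num.
  by exists (d * q - A)%num; subst; lia.
have [v ev] : exists v, (d * r = A + v)%num.
  by exists (d * r - A)%num; subst; lia.
have -> : (d * q - A = u)%num by lia.
exists v.
have euv : (d * q * (d * r) = (A + u) * (A + v))%num by rewrite eu ev.
have ed := f_equal (N.mul d) e.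
have ea1 := f_equal (N.mul A) eu; have ea2 := f_equal (N.mul A) ev.
subst A q r; lia.
Qed.

(** * Soundness of the search *)

Lemma searchP (allowed : seq N) (k : nat) (W : seq N) (last A B : N)
    (s : seq N) :
  search allowed k W last A B -> size s = k.+1 -> (0 < last)%num ->
  all plausible s -> pairwise admissible (last :: s) ->
  {in s, forall q, N.modulo q 210 \in W} ->
  (A * prod_predN s = B * prodN s + 2)%num -> (B * prodN s)%num \in allowed.
Proof.
elim: k W last A B s => [|k IH] W last A B [|q t] // + [st] last0
  /andP[plq plt] adm sW e.
all: have AB := balanced_gt _ _ _ e; rewrite [search _ _ _ _ _ _]/=.
all: have -> : N.leb A B = false by lia.
all: have [lastq adm'] : (last < q)%num /\ pairwise admissible (q :: t)
   by case/andP: adm => /andP[/andP[/N.ltb_lt ? _] _] ?.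
all: set d := (A - B)%num.
  case: t st e {plt sW adm adm'} => // _; rewrite /prod_predN /= => e.
  have er : (A + 2 = d * q)%num by rewrite /d; nia.
  have d0 : d <> 0%num by lia.
  rewrite er N.mul_comm N.Div0.mod_mul N.div_mul // plq /=.
  have -> : N.leb q last = false by lia.
  by rewrite N.mul_1_r.
set c := (A * A - _ + _)%num; set lo := N.max _ _; set hi := N.div _ d.
have ef : (A * (q - 1) * prod_predN t = B * q * prodN t + 2)%num.
  by move: e; rewrite /prod_predN /=; lia.
have Aq := balanced_gt _ _ _ ef.
(* [Aq] rearranges to A < d q. *)
have loq : (lo < q)%num.
  apply: N.max_lub_lt => //; apply: N.Div0.div_lt_upper_bound; rewrite /d; nia.
have qt : all (N.ltb q) t.
  by case/andP: adm' => /allP h _; apply/allP => x /h /andP[].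
have qhi : (q <= hi)%num.
  apply: N.div_le_lower_bound; first lia.
  have := balanced_head_le _ _ q _ _ _ _ e; rewrite -st; apply.
  - rewrite /= N.leb_refl; apply: sub_all qt => x; lia.
  - lia.
  - have t1 : all (N.ltb 1) t by apply: sub_all qt => x; lia.
    have := prod_predN_le t; have := prod_predN_gt0 t t1; rewrite /=; nia.
have tW x : x \in q :: t -> N.modulo x 210 \in refine last W.
  by move=> xs; apply: refineP (sW x xs); case/andP: adm => /allP-/(_ x xs).
have qrange : (lo / 210 <= q / 210 < lo / 210 +
    N.of_nat (N.to_nat (hi / 210 - lo / 210)).+1)%num.
  have := N.Div0.div_le_mono _ _ 210 (N.lt_le_incl _ _ loq).
  have := N.Div0.div_le_mono _ _ 210 qhi.
  by rewrite Nnat.Nat2N.inj_succ Nnat.N2Nat.id; lia.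
move=> sc; have {sc} := scanP _ _ _ _ q sc qrange (tW q (mem_head _ _)).
have -> : N.ltb lo q by lia.
have -> : N.ltb hi q = false by lia.
(* With two primes left the divisibility test replaces the sieve; [plausible q] is then consulted
   only if the continuation fails. *)
have -> : (if k is 0 then dvd_test (d * q - A)%num c else plausible q) = true.
  move: st; case: (k) => // st; move: st qt e.
  case: (t) => [|r []] //= _ /andP[/N.ltb_lt qr _] e.
  apply: dvd_testP; apply: (last_two_dvd A B q r); [lia | lia |].
  by move: e; rewrite /prod_predN /= !N.mul_1_r.
case: ifP => [sc _|_]; last by rewrite plq.
have -> : (B * prodN (q :: t) = B * q * prodN t)%num by rewrite N.mul_assoc.
apply: IH sc st _ plt adm' _ ef; first lia.
by move=> x xt; apply: tW; rewrite inE xt orbT.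
Qed.

(** * Running the search for one to six primes, all above 4 *)

Lemma search_le4 :
  all (fun k => search known_doubles k wheel0 4 3 2) (iota 0 4).
Proof. by vm_cast_no_check (erefl true). Qed.

Lemma search_5_6 : all (fun k => search [::] k wheel0 4 3 2) [:: 4; 5].
Proof. by vm_cast_no_check (erefl true). Qed.

(** * From lists of primes in [nat] to the search in [N] *)

Lemma of_nat_modn (q p : nat) :
  0 < p -> N.modulo (N.of_nat q) (N.of_nat p) = N.of_nat (q %% p).
Proof.
move=> p0; symmetry; apply: (N.mod_unique _ _ (N.of_nat (q %/ p))).
  by have := ltn_pmod q p0; lia.
by have := divn_eq q p; lia.
Qed.

Lemma prime_plausible (q : nat) : prime q -> plausible (N.of_nat q).
Proof.
move=> pq; apply/allP => p ps; case: ifP => // /N.eqb_eq.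
have [m -> m1] : exists2 m : nat, p = N.of_nat m & 1 < m.
  exists (N.to_nat p); first by rewrite Nnat.N2Nat.id.
  have : all (N.ltb 1) small_primes by [].
  by move=> /allP/(_ p ps); lia.
rewrite of_nat_modn; last lia.
move=> h; have /(prime_nt_dvdP pq) : m %| q by rewrite /dvdn; lia.
by move=> /(_ ltac:(lia)) ->; rewrite N.eqb_refl.
Qed.

Lemma prime_wheel0 (q : nat) :
  prime q -> 4 < q -> N.modulo (N.of_nat q) 210 \in wheel0.
Proof.
move=> pq q4; have := of_nat_modn q 210 isT => ->.
apply: map_f; rewrite mem_filter mem_iota leq0n ltn_mod andbT.
have d p : p \in [:: 2; 3] -> (p %| q %% 210) = false.
  move=> pp; have -> : (p %| q %% 210) = (p %| q).
    by move: pp; rewrite !inE => /orP[]/eqP ->; rewrite /dvdn modn_dvdm.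
  apply/negP => /(prime_nt_dvdP pq) h; move: pp; rewrite !inE.
  by case/orP=> /eqP e; subst p; have := h isT; lia.
rewrite -[6]/(2 * 3) coprimeMr !(coprime_sym _ 2, coprime_sym _ 3).
by rewrite !prime_coprime // !d.
Qed.

Lemma prodN_of_nat (s : seq nat) :
  prodN [seq N.of_nat q | q <- s] = N.of_nat (\prod_(q <- s) q).
Proof. by elim: s => [|q s IH]; rewrite ?big_nil // big_cons /= IH; lia. Qed.

Lemma prod_predN_of_nat (s : seq nat) :
  prod_predN [seq N.of_nat q | q <- s] = N.of_nat (\prod_(q <- s) q.-1).
Proof.
rewrite /prod_predN; elim: s => [|q s IH]; rewrite ?big_nil // big_cons /= IH.
by have -> : (N.of_nat q - 1 = N.of_nat q.-1)%num; lia.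
Qed.

Lemma not_dvd_pred (s : seq nat) (p q : nat) :
  3 * \prod_(x <- s) x.-1 = 2 * \prod_(x <- s) x + 2 ->
  p \in s -> q \in s -> prime p -> 2 < p -> ~~ (p %| q.-1).
Proof.
move=> e ps qs pp p2; apply/negP => pq.
have d1 : p %| \prod_(x <- s) x by rewrite (big_rem p) //= dvdn_mulr.
have d2 : p %| \prod_(x <- s) x.-1 by rewrite (big_rem q) //= dvdn_mulr.
have : p %| 2 by rewrite -(dvdn_addr _ (dvdn_mull 2 d1)) -e dvdn_mull.
by move=> /dvdn_leq; lia.
Qed.

Lemma prime_list_search (allowed : seq N) (s : seq nat) (k : nat) :
  search allowed k wheel0 4 3 2 -> size s = k.+1 -> sorted ltn s ->
  (forall q, q \in s -> prime q /\ 4 < q) ->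
  3 * \prod_(q <- s) q.-1 = 2 * \prod_(q <- s) q + 2 ->
  (2 * N.of_nat (\prod_(q <- s) q))%num \in allowed.
Proof.
move=> sc sz so prs e; rewrite -prodN_of_nat.
apply: (searchP _ _ _ _ _ _ _ sc); rewrite ?size_map //.
- by apply/allP => _ /mapP[q /prs[pq _] ->]; exact: prime_plausible.
- rewrite /=; apply/andP; split.
    (* The start value 4 does not divide 210, so only [4 < q] is asked here. *)
    by apply/allP => _ /mapP[q /prs[_ q4] ->]; rewrite /admissible /=; lia.
  rewrite pairwise_map; move: so; rewrite (sorted_pairwise ltn_trans).
  apply: (sub_in_pairwise (P := mem s)); last exact/allP.
  move=> p q ps qs pq.
  have [[pp p4] [pq' _]] := (prs p ps, prs q qs).
  rewrite /= /admissible of_nat_modn; last lia.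
  have nd := not_dvd_pred s p q e ps qs pp ltac:(lia).
  have nd0 : ~~ (p %| q).
    by apply/negP => /(prime_nt_dvdP pq') h; have := h ltac:(lia); lia.
  have : 1 < q %% p.
    rewrite ltn_neqAle lt0n -/(dvdn p q) nd0 andbT eq_sym.
    apply: contra nd => /eqP h; rewrite -subn1 -eqn_mod_dvd ?h ?modn_small; lia.
  by case: ifP => _; lia.
- by move=> _ /mapP[q /prs[pq q4] ->]; exact: prime_wheel0.
- by rewrite prodN_of_nat prod_predN_of_nat; lia.
Qed.

Lemma prime_list_solutions (s : seq nat) :
  sorted ltn s -> (forall q, q \in s -> prime q /\ 4 < q) -> size s <= 6 ->
  3 * \prod_(q <- s) q.-1 = 2 * \prod_(q <- s) q + 2 ->
  size s <= 4 /\ (2 * N.of_nat (\prod_(q <- s) q))%num \in known_doubles.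
Proof.
move=> so prs s6 e; case sz: (size s) => [|k].
  (* The empty list would give 3 = 4. *)
  by move: sz e => /size0nil ->; rewrite !big_nil.
have [k4|k4] := ltnP k 4.
  have sc : search known_doubles k wheel0 4 3 2.
    by apply: (allP search_le4); rewrite mem_iota.
  by split => //; exact: (prime_list_search _ _ _ sc).
have sc : search [::] k wheel0 4 3 2.
  by apply: (allP search_5_6); rewrite !inE; lia.
by have := prime_list_search _ _ _ sc sz so prs e.
Qed.

(** * Reduction of the totient equation to prime lists *)

Lemma totient_le (n : nat) : totient n <= n.
Proof.
rewrite totient_count_coprime -[leqRHS]subn0 -[leqRHS]muln1 -sum_nat_const_nat.
by apply: leq_sum => i _; case: coprime.
Qed.

(** Excludes even solutions. It follows from phi(2^k m) = 2^(k-1) phi(m) for odd m and k > 0. *)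
Lemma even_totient_le (n : nat) : 0 < n -> 2 %| n -> 2 * totient n <= n.
Proof.
move=> n0 n2; have [m com en] := pfactor_coprime (isT : prime 2) n0.
have k0 : 0 < logn 2 n by rewrite logn_gt0 mem_primes n0 n2.
rewrite en totient_coprime; last by rewrite coprime_sym coprimeXl.
rewrite totient_pfactor // mul1n mulnCA -expnS prednK //.
by rewrite leq_mul2r totient_le orbT.
Qed.

Lemma totient_eq_squarefree (n : nat) : 0 < n -> 3 * totient n = 2 * n + 2 ->
  [/\ forall p, p \in primes n -> prime p /\ 4 < p,
      totient n = \prod_(p <- primes n) p.-1 & n = \prod_(p <- primes n) p].
Proof.
move=> n0 e.
have n2 : (2 %| n) = false by apply/negP => /(even_totient_le _ n0); lia.
have prs p : p \in primes n -> [/\ prime p, 4 < p & logn p n = 1].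
  rewrite mem_primes => /and3P[pp _ pn].
  have p2 : p <> 2 by move=> p2; rewrite p2 n2 in pn.
  (* Otherwise 3 would divide 3 phi(n) - 2 n = 2. *)
  have p3 : p <> 3 by move=> p3; move: pn; rewrite p3; lia.
  have p4 : p <> 4 by move=> p4; rewrite p4 in pp.
  have p1 := prime_gt1 pp; split=> //; first lia.
  have : 0 < logn p n by rewrite logn_gt0 mem_primes pp n0.
  case: (leqP (logn p n) 1) => [|l _]; first lia.
  (* If the square of [p] divides [n], then [p] divides both [n] and its totient, hence 2. *)
  suff /dvdn_leq : p %| 2 by lia.
  rewrite -(dvdn_addr _ (dvdn_mull 2 pn)) -e dvdn_mull // totientE //.
  have ps : p \in primes n by rewrite mem_primes pp n0.
  rewrite (big_rem p) //= dvdn_mulr // dvdn_mull //.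
  by rewrite dvdn_exp // -subn1 subn_gt0.
split; first by move=> p /prs[].
  by rewrite totientE //; apply: eq_big_seq => p /prs[_ _ ->]; rewrite muln1.
rewrite {1}(prod_prime_decomp n0) prime_decompE big_map.
by apply: eq_big_seq => p /prs[_ _ ->].
Qed.

Theorem theorem11 :
  (~ exists Q : {fset nat},
      [/\ forall q : nat, q \in Q -> prime q,
          2 \notin Q,
          3 \notin Q,
          #|` Q|%fset = 5 \/ #|` Q|%fset = 6
        & (3 * (\prod_(q <- Q) (q%:Z - 1)) - 2 * (\prod_(q <- Q) q%:Z) = 2 :> int)%R])
  /\
  (forall n : nat, 0 < n ->
      ((totient n)%:R = 2 / 3 * (n%:R + 1) :> rat)%R ->
      n \notin [:: 5; 5 * 7; 5 * 7 * 37; 5 * 7 * 37 * 1297] ->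
      7 <= size (primes n)).
Proof.
split.
- case=> Q [Qp Q2 Q3 Qs e].
  set s := sort leq Q.
  have sQ : perm_eq Q s by rewrite perm_sym perm_sort.
  have prs q : q \in s -> prime q /\ 4 < q.
    rewrite -(perm_mem sQ) => qQ; have pq := Qp q qQ; have q1 := prime_gt1 pq.
    have q2 : q <> 2 by move=> q2; rewrite -q2 qQ in Q2.
    have q3 : q <> 3 by move=> q3; rewrite -q3 qQ in Q3.
    by have q4 : q <> 4; [move=> q4; rewrite q4 in pq | split=> //; lia].
  have so : sorted ltn s.
    rewrite ltn_sorted_uniq_leq sort_uniq fset_uniq.
    by rewrite sort_sorted //; exact: leq_total.
  have szs : size s = 5 \/ size s = 6 by rewrite size_sort.
  have es : 3 * \prod_(q <- s) q.-1 = 2 * \prod_(q <- s) q + 2.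
    have e1 : (\prod_(q <- Q) (q%:Z - 1) = (\prod_(q <- s) q.-1)%:Z)%R.
      rewrite (perm_big _ sQ) /= (big_morph Posz PoszM (erefl _)).
      by apply: eq_big_seq => q /prs[_ q4]; lia.
    have e2 : (\prod_(q <- Q) q%:Z = (\prod_(q <- s) q)%:Z)%R.
      by rewrite (perm_big _ sQ) /= (big_morph Posz PoszM (erefl _)).
    by move: e; rewrite e1 e2; lia.
  have [] := prime_list_solutions s so prs _ es; lia.
(* By contraposition: with at most six prime factors, 2 n is one of [known_doubles]. *)
- move=> n n0 e; apply: contraNT; rewrite -ltnNge => sz.
  have en : 3 * totient n = 2 * n + 2.
    apply/eqP; rewrite -(Num.Theory.eqr_nat rat).
    rewrite GRing.natrM GRing.natrD GRing.natrM e.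
    by apply/eqP; field.
  have [prs et ep] := totient_eq_squarefree n n0 en.
  have [] := prime_list_solutions _ (sorted_primes n) prs sz _.
    by rewrite -et -ep.
  by rewrite -ep !inE => _ /or4P[]/eqP h; apply/or4P; 
    [constructor 1|constructor 2|constructor 3|constructor 4]; apply/eqP; lia.
Qed.
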